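(* For every integer $n\ge 3$, the complete graph $K_n$ satisfies $Z_g(K_n)=Z(K_n)=n-1$.
   Context: All graphs are finite and simple. Classical zero forcing: given a set of coloured vertices (all others white), if a coloured vertex $u$ has exactly one white neighbour $v$, then $u$ may force $v$, i.e. colour it. A zero forcing set is a set of initially coloured vertices from which repeated forcing can colour all vertices of $G$; the zero forcing number $Z(G)$ is the minimum size of a zero forcing set. The game: Let $G$ be a connected graph with at least one edge; initially all vertices are white. Alice (blue) and Bob (red) alternate turns, Alice first. On each turn the player makes exactly one move: a seed move (colour one white vertex with the player's colour) or a force move $u\to v$ (if a vertex $u$ of the player's colour has exactly one white neighbour $v$, colour $v$ with the player's colour). Being the unique white neighbour is with respect to all white vertices, irrespective of who coloured the others. If a white vertex is the target of one of the player's own legal forces, colouring it counts as a force move and not as a seed move. A move blocks a legal force $u\to v$ if that force is no longer legal after the move. Force Preservation Rule: considering the opponent's legal forces (those the opponent's coloured vertices could make) at the beginning of a turn, (i) a player may always perform one of their own legal forces, even if this blocks a force of the opponent; (ii) a seed move that blocks a legal force of the opponent is permitted only when every available seed move blocks at least one of the opponent's legal forces. The game ends when every vertex is coloured. Optimal play and $Z_g$: For a position $P$ define a set $\mathcal O(P)$ of pairs. If $P$ is terminal and Alice and Bob made $s_A$ and $s_B$ seed moves in total, then $\mathcal O(P)=\{(s_A,s_B)\}$. Otherwise let $\mathcal U(P)=\bigcup_m \mathcal O(P_m)$ over all legal moves $m$, where $P_m$ is the resulting position; $\mathcal O(P)$ is the set of all pairs in $\mathcal U(P)$ with minimum first coordinate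 if Alice is to move, and with minimum second coordinate if Bob is to move. Let $\mathcal O(G)=\mathcal O(P_0(G))$ for the initial position $P_0(G)$. The game zero forcing number is $Z_g(G)=\min\{s_A+s_B:(s_A,s_B)\in\mathcal O(G)\}$. *)

(* Defs.v *)
From mathcomp Require Import all_boot.

Set Implicit Arguments.
Unset Strict Implicit.
Unset Printing Implicit Defensive.

Record sgraph := SGraph {
  vertex :> finType;
  edge : rel vertex;
  edge_sym : symmetric edge;
  edge_irrefl : irreflexive edge
}.

Section Complete.
Variable n : nat.

Definition complete_edge : rel 'I_n := fun u v => u != v.

Lemma complete_edge_sym : symmetric complete_edge.
Proof. by move=> u v; rewrite /complete_edge eq_sym. Qed.

Lemma complete_edge_irrefl : irreflexive complete_edge.
Proof. by move=> u; rewrite /complete_edge eqxx. Qed.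

Definition complete_graph : sgraph :=
  SGraph complete_edge_sym complete_edge_irrefl.

End Complete.

Notation "''K_' n" := (complete_graph n)
  (at level 8, n at level 2, format "''K_' n").

Section ZeroForcing.
Variable G : sgraph.
Implicit Types (S W : {set G}) (u v : G).

Definition unique_white_nbr W u v : bool :=
  [set w in W | edge u w] == [set v].

Definition force_step : rel {set G} := fun S S' =>
  [exists u, exists v,
     [&& u \in S, unique_white_nbr (~: S) u v & S' == v |: S]].

Definition zero_forcing_set S : bool := connect force_step S [set: G].

(* The default [set: G] is itself a zero forcing set, so this is a minimum
   over a nonempty family. *)
Definition zero_forcing_number : nat :=
  #|[arg min_(S < [set: G] | zero_forcing_set S) #|S| ]|.

End ZeroForcing.

Definition player := bool.
Definition Alice : player := true.
Definition Bob : player := false.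
Definition opponent (p : player) : player := ~~ p.

(* [None] is white. *)
Definition colouring (G : sgraph) := {ffun G -> option player}.

Record position (G : sgraph) := Position {
  col : colouring G;
  turn : player;
  seedsA : nat;
  seedsB : nat
}.

Inductive move (G : sgraph) := Seed of G | Force of G & G.
Arguments Seed {G} v.
Arguments Force {G} u v.

(* Meaningful as the minimum only for a nonempty sequence. *)
Definition seq_min (s : seq nat) : nat := \big[minn/head 0 s]_(x <- s) x.

Section Game.
Variable G : sgraph.
Implicit Types (c : colouring G) (p : player) (u v w : G) (P : position G).

Definition white c : {set G} := [set v | c v == None].

Definition paint c p v : colouring G :=
  [ffun w => if w == v then Some p else c w].

Definition legal_force c p u v : bool :=
  (c u == Some p) && unique_white_nbr (white c) u v.

(* A white vertex that the player can force is not available as a seed. *)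
Definition available_seed c p v : bool :=
  (v \in white c) && ~~ [exists u, legal_force c p u v].

Definition seed_blocks c p v : bool :=
  [exists u, exists w, legal_force c (opponent p) u w
                       && ~~ legal_force (paint c p v) (opponent p) u w].

(* The Force Preservation Rule: seeds are restricted, forces are not. *)
Definition legal_seed c p v : bool :=
  available_seed c p v &&
  (seed_blocks c p v ==>
     [forall w, available_seed c p w ==> seed_blocks c p w]).

Definition legal P (m : move G) : bool :=
  match m with
  | Seed v => legal_seed (col P) (turn P) v
  | Force u v => legal_force (col P) (turn P) u v
  end.

Definition play P (m : move G) : position G :=
  let p := turn P in
  match m with
  | Seed v => Position (paint (col P) p v) (opponent p)
                (seedsA P + (p == Alice)) (seedsB P + (p == Bob))
  | Force _ v => Position (paint (col P) p v) (opponent p)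
                   (seedsA P) (seedsB P)
  end.

Definition all_moves : seq (move G) :=
  [seq Seed v | v <- enum G] ++
  [seq Force u v | u <- enum G, v <- enum G].

Definition legal_moves P : seq (move G) := [seq m <- all_moves | legal P m].

Definition own_seeds p (s : nat * nat) : nat :=
  if p == Alice then s.1 else s.2.

Definition optimal p (U : seq (nat * nat)) : seq (nat * nat) :=
  [seq s <- U | all (fun t => own_seeds p s <= own_seeds p t) U].

(* Every legal move colours exactly one white vertex, so starting the
   recursion at the number of white vertices makes [k = 0] coincide with
   the terminal positions. *)
Fixpoint outcomes_rec (k : nat) P : seq (nat * nat) :=
  if k is k'.+1 then
    optimal (turn P)
      (flatten [seq outcomes_rec k' (play P m) | m <- legal_moves P])
  else [:: (seedsA P, seedsB P)].

Definition outcomes P : seq (nat * nat) := outcomes_rec #|white (col P)| P.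

Definition initial_position : position G :=
  Position [ffun=> None] Alice 0 0.

(* The game is meant for connected graphs with at least one edge; the
   definition makes sense without these assumptions. *)
Definition game_zero_forcing_number : nat :=
  seq_min [seq s.1 + s.2 | s <- outcomes initial_position].

End Game.

(* Main.v *)
From HB Require Import structures.
Require Import Defs.
From mathcomp Require Import all_boot.
From mathcomp Require Import zify.

(** In a complete graph every coloured vertex is adjacent to every white one,
    so a force is legal exactly when a single white vertex is left. Hence a
    play consists of seed moves until one white vertex remains; the player to
    move then already owns a vertex because [n >= 3], so the last vertex must
    be forced, and every play uses [n - 1] seed moves whatever the players'
    choices. Likewise a set with at least two vertices missing cannot force
    anything. *)

Set Implicit Arguments.
Unset Strict Implicit.
Unset Printing Implicit Defensive.

Section MoveEqType.
Variable G : sgraph.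

(** An equality on moves is needed to speak of membership in [legal_moves]; it is transported from
    this sum type. *)
Definition move_code (m : move G) : G + G * G :=
  match m with Seed v => inl v | Force u v => inr (u, v) end.

Definition move_decode (x : G + G * G) : move G :=
  match x with inl v => Seed v | inr (u, v) => Force u v end.

Lemma move_codeK : cancel move_code move_decode.
Proof. by case. Qed.

HB.instance Definition _ := Equality.copy (move G) (can_type move_codeK).

End MoveEqType.

Section Moves.
Variable G : sgraph.
Implicit Types (P : position G) (m : move G) (c : colouring G) (p : player).

Definition target m : G := match m with Seed v => v | Force _ v => v end.

Lemma mem_all_moves m : m \in all_moves G.
Proof.
rewrite mem_cat; case: m => [v|u v]; apply/orP; [left|right].
  by apply: map_f; rewrite mem_enum.
by apply: allpairs_f; rewrite mem_enum.
Qed.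

Lemma mem_legal_moves P m : (m \in legal_moves P) = legal P m.
Proof. by rewrite mem_filter mem_all_moves andbT. Qed.

Lemma legal_target_white P m : legal P m -> target m \in white (col P).
Proof.
case: m => [v|u v] /=; first by case/andP => /andP[].
by case/andP=> _ /eqP/setP/(_ v); rewrite !inE eqxx => /andP[].
Qed.

Lemma col_play P m : col (play P m) = paint (col P) (turn P) (target m).
Proof. by case: m. Qed.

Lemma turn_play P m : turn (play P m) = opponent (turn P).
Proof. by case: m. Qed.

Lemma white_paint c p v : white (paint c p v) = white c :\ v.
Proof. by apply/setP=> w; rewrite !inE ffunE; case: (w == v). Qed.

Lemma paint_keeps_colour c p q v :
  v \in white c -> (exists u, c u = Some q) ->
  exists u, paint c p v u = Some q.
Proof.
rewrite inE => /eqP cv [u cu]; exists u; rewrite ffunE.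
by case: (u =P v) => // uv; rewrite uv cv in cu.
Qed.

End Moves.

Lemma mem_optimal p U : {subset optimal p U <= U}.
Proof. by move=> s; rewrite mem_filter => /andP[]. Qed.

(** The values of [own_seeds] attain a minimum. This keeps [outcomes] nonempty, so that the default
    of [seq_min] never matters. *)
Lemma optimal_neq_nil p U : U != [::] -> optimal p U != [::].
Proof.
case: U => [//|s0 U] _; set V := s0 :: U.
have exU : exists k, k \in map (own_seeds p) V.
  by exists (own_seeds p s0); rewrite mem_head.
case: (ex_minnP exU) => k /mapP[s sV ->] smin.
have: s \in optimal p V.
  by rewrite mem_filter sV andbT; apply/allP=> t tV; apply/smin/map_f.
by case: (optimal p V).
Qed.

Lemma seq_min_nseq k a : seq_min (nseq k.+1 a) = a.
Proof.
rewrite /seq_min /=.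
by elim: k => [|k IHk]; rewrite big_cons ?big_nil ?IHk minnn.
Qed.

Section CompleteGraph.
Variable n : nat.
Implicit Types (P : position 'K_n) (c : colouring 'K_n) (S W : {set 'K_n}).

Lemma card_complete : #|'K_n| = n.
Proof. exact: card_ord. Qed.

Lemma unique_white_nbr_complete W (u v : 'K_n) :
  u \notin W -> unique_white_nbr W u v = (W == [set v]).
Proof.
move=> uW; rewrite /unique_white_nbr; congr (_ == _).
apply/setP=> w; rewrite inE; case: (boolP (w \in W)) => //= wW.
by rewrite /complete_edge; apply: contraNneq uW => ->.
Qed.

Lemma legal_force_complete c p (u v : 'K_n) :
  legal_force c p u v = (c u == Some p) && (white c == [set v]).
Proof.
rewrite /legal_force; case: eqP => //= cu.
by rewrite unique_white_nbr_complete // inE cu.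
Qed.

(** With two white vertices neither player has a legal force, so [v] is not a force target and there
    is nothing to block: the Force Preservation Rule is vacuous. *)
Lemma legal_seed_complete P (v : 'K_n) :
  1 < #|white (col P)| -> v \in white (col P) -> legal P (Seed v).
Proof.
move=> W2 vW.
have noforce p u w : legal_force (col P) p u w = false.
  rewrite legal_force_complete; case: eqP => //= _.
  by apply: contraTF W2 => /eqP ->; rewrite cards1.
rewrite /= /legal_seed /available_seed vW /=; apply/andP; split.
  by apply/existsP=> -[u]; rewrite noforce.
suff -> : seed_blocks (col P) (turn P) v = false by [].
by apply/existsP=> -[u /existsP[w]]; rewrite noforce.
Qed.

(** Induction on the number [k] of white vertices: all of them but the last are still to be seeded.
    The two ownership hypotheses say that the opponent has moved once a vertex is coloured, and the
    player to move once two are. *)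
Lemma outcomes_rec_complete k P :
    2 < n -> #|white (col P)| = k ->
    (k < n -> exists u, col P u = Some (opponent (turn P))) ->
    (k.+1 < n -> exists u, col P u = Some (turn P)) ->
  outcomes_rec k P != [::] /\
  {in outcomes_rec k P, forall s, s.1 + s.2 = seedsA P + seedsB P + k.-1}.
Proof.
move=> n3; elim: k P => [|k IHk] P Wk opp own /=.
  by split=> // s; rewrite inE => /eqP ->; rewrite addn0.
have IHm m : legal P m -> outcomes_rec k (play P m) != [::] /\
    {in outcomes_rec k (play P m), forall s,
       s.1 + s.2 = seedsA (play P m) + seedsB (play P m) + k.-1}.
  move=> /legal_target_white mW; apply: IHk.
  - by rewrite col_play white_paint; move: Wk; rewrite (cardsD1 (target m)) mW => -[].
  (* The roles swap: the mover, now the opponent, owns the vertex just painted, and the old [opp]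
     supplies the new [own]. *)
  - move=> _; exists (target m).
    by rewrite col_play turn_play ffunE eqxx /opponent negbK.
  by move=> kn; rewrite col_play turn_play; apply/paint_keeps_colour/opp.
(* A force happens only at [k = 0], where [k.-1 = k]. A seed needs [0 < k]: at [k = 0] the mover
   owns a vertex, by [own] and [2 < n], and can force the last white one, which is thus no seed. *)
have seedsE m : legal P m ->
    seedsA (play P m) + seedsB (play P m) + k.-1 = seedsA P + seedsB P + k.
  case: m => [v|u v] /= legm; last first.
    move: legm; rewrite legal_force_complete => /andP[_ /eqP W1].
    by move: Wk; rewrite W1 cards1 => -[<-].
  suff k0 : 0 < k by case: (turn P); rewrite /Alice /Bob /=; lia.
  rewrite lt0n; apply/negP=> /eqP k0; rewrite k0 in Wk own.
  move/eqP/cards1P: Wk => [w W1]; have [u cu] := own n3.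
  case/andP: legm => /andP[]; rewrite W1 inE => /eqP -> /existsP[].
  by exists u; rewrite legal_force_complete cu W1 !eqxx.
have [m legm] : exists m, legal P m.
  case: (posnP k) => k0; last first.
    have /card_gt0P[v vW] : 0 < #|white (col P)| by rewrite Wk.
    by exists (Seed v); apply: legal_seed_complete; rewrite ?Wk.
  rewrite k0 in Wk own; move/eqP/cards1P: Wk => [w W1].
  have [u cu] := own n3; exists (Force u w).
  by rewrite /= legal_force_complete cu W1 !eqxx.
split.
  apply: optimal_neq_nil; have [+ _] := IHm m legm.
  case E: (outcomes_rec k (play P m)) => [//|s r] _.
  have: s \in flatten [seq outcomes_rec k (play P m0) | m0 <- legal_moves P].
    apply/flatten_mapP; exists m; first by rewrite mem_legal_moves.
    by rewrite E mem_head.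
  by case: (flatten _).
(* Every legal continuation has the same sum, so membership in the unfiltered list suffices. *)
move=> s /mem_optimal/flatten_mapP[m']; rewrite mem_legal_moves => legm' s_m'.
by have [_ /(_ s s_m') ->] := IHm m' legm'; rewrite seedsE.
Qed.

Lemma game_zero_forcing_number_complete :
  2 < n -> game_zero_forcing_number 'K_n = n.-1.
Proof.
move=> n3; set P0 := initial_position 'K_n.
have W0 : #|white (col P0)| = n.
  rewrite -[RHS]card_complete -cardsT; congr #|pred_of_set _|.
  by apply/setP=> v; rewrite !inE ffunE.
(* At [k = n] both ownership hypotheses have false premises. *)
have [] := @outcomes_rec_complete n P0 n3 W0; [by rewrite ltnn | lia |].
rewrite /game_zero_forcing_number /outcomes -/P0 W0.
set O := outcomes_rec n P0 => O0 sumO.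
have /all_pred1P -> : all (pred1 n.-1) [seq s.1 + s.2 | s <- O].
  by apply/allP=> _ /mapP[s sO ->]; rewrite /= (sumO s sO).
by rewrite size_map; case: O O0 {sumO} => [//|s r] _; rewrite seq_min_nseq.
Qed.

Lemma zero_forcing_set_complete S :
  1 < n -> zero_forcing_set S = (n.-1 <= #|S|).
Proof.
move=> n2; have SC : #|S| + #|~: S| = n by rewrite cardsC card_complete.
apply/idP/idP => [/connectP[[|S' p] /=]|Sn].
- by move=> _ <-; rewrite cardsT card_complete leq_pred.
(* The first force alone shows that only one vertex lies outside [S]. *)
- case/andP=> /existsP[u /existsP[v /and3P[uS + _]]] _ _.
  rewrite unique_white_nbr_complete ?inE ?uS // => /eqP W1.
  by move: SC; rewrite W1 cards1 addn1 => /(congr1 predn) /= <-.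
have [/cards0_eq W0|W0] := posnP #|~: S|.
  by rewrite -[S]setCK W0 setC0; apply: connect0.
have /eqP/cards1P[v W1] : #|~: S| = 1 by move: SC Sn W0; lia.
have /card_gt0P[u uS] : 0 < #|S| by lia.
apply/connect1/existsP; exists u; apply/existsP; exists v.
rewrite uS unique_white_nbr_complete ?inE ?uS // W1 eqxx /=.
by rewrite -W1 setUC setUCr.
Qed.

Lemma zero_forcing_number_complete :
  1 < n -> zero_forcing_number 'K_n = n.-1.
Proof.
move=> n2; rewrite /zero_forcing_number; case: arg_minnP.
  exact: connect0.
move=> S; rewrite zero_forcing_set_complete // => Sn Smin.
apply/eqP; rewrite eqn_leq Sn andbT.
(* The complement of a single vertex is a zero forcing set and bounds the minimum from above. *)
have v0 : 'K_n by exact: (Ordinal (ltnW n2)).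
have card1 : #|~: [set v0]| = n.-1 by rewrite cardsC1 card_complete.
by rewrite -[leqRHS]card1; apply: Smin; rewrite zero_forcing_set_complete ?card1.
Qed.

End CompleteGraph.

Theorem proposition11 (n : nat) (hn : 3 <= n) :
  game_zero_forcing_number 'K_n = zero_forcing_number 'K_n /\
  zero_forcing_number 'K_n = n - 1.
Proof.
by rewrite game_zero_forcing_number_complete // zero_forcing_number_complete
  ?subn1 // ltnW.
Qed.
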